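(* Let $H\in(0,1)$. For every $(a,b)\in\mathbb{R}^2\setminus\{(0,0)\}$, the increments of the generalized fractional Brownian motion $Z^H(a,b)$ with parameters $a,b,H$ are long-range dependent if and only if $H>\frac12$ and $a\ne b$.
   Context: For $H\in(0,1)$, a two-sided fractional Brownian motion with Hurst parameter $H$ is a centered Gaussian process $B^H=(B_t^H)_{t\in\mathbb{R}}$ on a probability space $(\Omega,F,\mathbb{P})$ with covariance $\operatorname{Cov}(B_t^H,B_s^H)=\frac12\bigl(|s|^{2H}+|t|^{2H}-|t-s|^{2H}\bigr)$ for $s,t\in\mathbb{R}$. For real $a,b$ with $(a,b)\ne(0,0)$, the generalized fractional Brownian motion (gfBm) with parameters $a,b,H$ is the process $Z^H(a,b)=(Z_t^H(a,b))_{t\ge0}$ defined by $Z_t^H(a,b)=aB_t^H+bB_{-t}^H$ for $t\ge 0$. The increments of a stochastic process $X=(X_t)_{t\ge0}$ are called long-range dependent if for every integer $p\ge1$, $\sum_{n\ge1}R_X(p,p+n)=\infty$, where $R_X(p,p+n)=\mathbb{E}\bigl((X_{p+1}-X_p)(X_{p+n+1}-X_{p+n})\bigr)$. *)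

(* Defs.v *)
From HB Require Import structures.
From mathcomp Require Import all_boot all_order all_algebra.
From mathcomp Require Import all_classical all_reals all_analysis.
From mathcomp Require Import measurable_realfun.

Import Order.TTheory GRing.Theory Num.Theory.
Import numFieldNormedType.Exports.

Local Open Scope classical_set_scope.
Local Open Scope ring_scope.

(* Gaussian laws include the degenerate ones (point masses), which occur for
   instance at time 0.  The case [s = 0] is separated because [normal_prob m 0]
   is by convention the uniform law on [0, 1]. *)
Definition gaussian_rv {d : measure_display} {T : measurableType d}
    {R : realType} (P : probability T R) (Y : {RV P >-> R}) : Prop :=
  exists m s : R, forall A : set R, measurable A ->
    distribution P Y A = if s == 0 then \d_m A else normal_prob m s A.

Definition gaussian_process {d : measure_display} {T : measurableType d}
    {R : realType} (P : probability T R) {I : Type}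
    (X : I -> {RV P >-> R}) : Prop :=
  forall (n : nat) (t : 'I_n -> I) (c : 'I_n -> R),
    gaussian_rv P (\sum_(i < n) scale_mfun (c i) (X (t i))).

Definition centered_process {d : measure_display} {T : measurableType d}
    {R : realType} (P : probability T R) {I : Type}
    (X : I -> {RV P >-> R}) : Prop :=
  forall t : I, ('E_P[X t] = 0)%E.

Definition two_sided_fBm {d : measure_display} {T : measurableType d}
    {R : realType} (P : probability T R) (H : R)
    (B : R -> {RV P >-> R}) : Prop :=
  [/\ gaussian_process P B, centered_process P B &
      forall s t : R, covariance P (B t) (B s) =
        (2^-1 * (`|s| `^ (2 * H) + `|t| `^ (2 * H) - `|t - s| `^ (2 * H)))%:E].

Definition gfBm {d : measure_display} {T : measurableType d}
    {R : realType} (P : probability T R) (a b : R)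
    (B : R -> {RV P >-> R}) (t : {nonneg R}) : {RV P >-> R} :=
  (a \o* B t%:num) \+ (b \o* B (- t%:num)).

Definition increment_cov {d : measure_display} {T : measurableType d}
    {R : realType} (P : probability T R)
    (X : {nonneg R} -> {RV P >-> R}) (p q : nat) : \bar R :=
  ('E_P[((X p.+1%:R%:nng \- X p%:R%:nng) \*
         (X q.+1%:R%:nng \- X q%:R%:nng))%R])%E.

(* [\sum_n R_X(p, p + n) = oo] is read as divergence of the partial sums to
   [+oo]; the terms need not be nonnegative. *)
Definition long_range_dependent {d : measure_display} {T : measurableType d}
    {R : realType} (P : probability T R)
    (X : {nonneg R} -> {RV P >-> R}) : Prop :=
  forall p : nat, (1 <= p)%N ->
    (fun N : nat => (\sum_(1 <= n < N.+1) increment_cov P X p (p + n))%E)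
      @ \oo --> +oo%E.

(* Main.v *)
(* With D n = (n + 1)^(2H) - n^(2H), the covariance R(p, p + n) is
     (a^2 + b^2)/2 (D n - D (n - 1)) - a b (D (n + 2p + 1) - D (n + 2p)),
   so its sum over 1 <= n <= N telescopes to
     (a^2 + b^2)/2 (D N - D 0) - a b (D (N + 2p + 1) - D (2p + 1)).
   If H <= 1/2, then 0 <= D <= 1 and the sums are bounded.  If H > 1/2, then
   D N tends to infinity while D (N + 2p + 1) - D N stays bounded (both by the
   mean value theorem), so the sums are (a - b)^2/2 D N + O(1). *)

Require Import Defs.
From mathcomp Require Import all_boot all_order all_algebra.
From mathcomp Require Import all_classical all_reals all_analysis.
From mathcomp Require Import measurable_realfun.
From mathcomp Require Import ring lra zify.

Set Implicit Arguments.
Unset Strict Implicit.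
Unset Printing Implicit Defensive.

Import Order.TTheory GRing.Theory Num.Theory.
Import numFieldNormedType.Exports.

Local Open Scope classical_set_scope.
Local Open Scope ring_scope.

(** Turns a finite second moment into the L^2 membership that the bilinearity rules for covariance
    ask for. *)
Lemma Lfun2_sqr_lty {R : realType} (d : measure_display)
    (T : measurableType d) (P : probability T R) (X : {RV P >-> R}) :
  ('E_P[(X : T -> R) * X] < +oo)%E -> (X : T -> R) \in Lfun P 2%:E.
Proof.
rewrite unlock => hX; rewrite inE; apply/andP; split; rewrite inE/=.
  exact: measurable_funPT.
rewrite /finite_norm unlock /Lnorm poweR_lty//.
congr (_ < _)%E: hX; apply: eq_integral => w _ /=.
by rewrite powR_mulrn// -normrX ger0_norm ?sqr_ge0// expr2.
Qed.

(** * Increments of power functions: [powR_incr (2 * H) n] is the D n above *)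

Definition powR_incr {R : realType} (r : R) (n : nat) : R :=
  n.+1%:R `^ r - n%:R `^ r.

Lemma powR_incr_MVT {R : realType} (r : R) (n : nat) : (0 < n)%N ->
  exists2 c, c \in `](n%:R : R), n.+1%:R[ & powR_incr r n = r * c `^ (r - 1).
Proof.
move=> n0.
have h (x : R) : n%:R <= x -> is_derive x 1 (@powR R ^~ r) (r * x `^ (r - 1)).
  by move=> nx; apply: is_derive1_powR; apply: lt_le_trans nx; rewrite ltr0n.
have := @MVT R (@powR R ^~ r) (fun x => r * x `^ (r - 1)) n%:R n.+1%:R.
case.
- by rewrite ltr_nat.
- by move=> x; rewrite in_itv/= => /andP[/ltW nx _]; exact: h.
- apply: derivable_within_continuous => x; rewrite in_itv/= => /andP[nx _].
  exact: (@ex_derive _ _ _ _ _ _ _ (h x nx)).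
- move=> c hc; rewrite -natr1 addrAC subrr add0r mulr1 natr1 => e.
  by exists c.
Qed.

Lemma powR_incr_ge0 {R : realType} (r : R) (n : nat) :
  0 <= r -> 0 <= powR_incr r n.
Proof.
by move=> r0; rewrite subr_ge0 ge0_ler_powR ?nnegrE// ler_nat.
Qed.

Lemma powR_incr_le1 {R : realType} (r : R) (n : nat) :
  0 <= r <= 1 -> powR_incr r n <= 1.
Proof.
move=> /andP[r0 r1]; case: n => [|n].
  have -> : powR_incr r 0 = 1 - 0 `^ r by rewrite /powR_incr powR1.
  by rewrite gerBl powR_ge0.
have [c] := powR_incr_MVT r (ltn0Sn n).
rewrite in_itv/= => /andP[nc _] ->.
(* Since c >= 1 and r - 1 <= 0, both factors of r c^(r - 1) are at most 1. *)
have c1 : 1 <= c by apply: le_trans (ltW nc); rewrite ler1n.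
rewrite -[leRHS]mul1r ler_pM ?powR_ge0//.
by rewrite -[leRHS](powRr0 c) ler_powR// subr_le0.
Qed.

Lemma powR_incr_bounds {R : realType} (r : R) (n : nat) : 1 <= r -> (0 < n)%N ->
  r * n%:R `^ (r - 1) <= powR_incr r n <= r * n.+1%:R `^ (r - 1).
Proof.
move=> r1 n0; have [c] := powR_incr_MVT r n0.
have r0 : 0 <= r by lra.
have r10 : 0 <= r - 1 by lra.
rewrite in_itv/= => /andP[/ltW nc /ltW cn] ->.
have c0 : 0 <= c by apply: le_trans nc.
by rewrite !ler_wpM2l// ge0_ler_powR// ?nnegrE.
Qed.

(** The left side is a sum of k unit increments, each at most 1. *)
Lemma powR_shift_le {R : realType} (r : R) (n k : nat) :
  0 <= r <= 1 -> (n + k)%:R `^ r - n%:R `^ r <= k%:R.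
Proof.
move=> r01; elim: k => [|k IH]; first by rewrite addn0 subrr.
have := powR_incr_le1 (n + k) r01.
by rewrite /powR_incr addnS -(natr1 k); move: IH; lra.
Qed.

(** By the mean value bounds, both increments lie between r n^(r - 1) and r (n + k + 1)^(r - 1). As
    r - 1 is in [0, 1], [powR_shift_le] over k + 1 steps bounds the length of this interval. *)
Lemma powR_incr_shift {R : realType} (r : R) (n k : nat) :
  1 <= r <= 2 -> (0 < n)%N ->
  `|powR_incr r (n + k) - powR_incr r n| <= r * k.+1%:R.
Proof.
move=> /andP[r1 r2] n0; have r0 : 0 <= r by lra.
have nk0 : (0 < n + k)%N by rewrite addn_gt0 n0.
have /andP[l1 u1] := powR_incr_bounds r1 n0.
have /andP[l2 u2] := powR_incr_bounds r1 nk0.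
have r11 : 0 <= r - 1 <= 1 by lra.
have := powR_shift_le n k.+1 r11; rewrite addnS => /(ler_wpM2l r0) h1.
have : r * (n%:R `^ (r - 1)) <= r * ((n + k)%:R `^ (r - 1)).
  by rewrite ler_wpM2l// ge0_ler_powR ?nnegrE ?ler_nat ?leq_addr//; lra.
have : r * (n.+1%:R `^ (r - 1)) <= r * ((n + k).+1%:R `^ (r - 1)).
  by rewrite ler_wpM2l// ge0_ler_powR ?nnegrE ?ler_nat ?ltnS ?leq_addr//; lra.
rewrite mulrBr in h1.
by rewrite ler_norml; lra.
Qed.

Lemma cvgy_powR_incr {R : realType} (r : R) :
  1 < r -> powR_incr r n @[n --> \oo] --> +oo.
Proof.
move=> r1; apply/cvgryPge => A.
have r10 : 0 < r - 1 by rewrite subr_gt0.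
near=> n.
have n0 : (0 < n)%N by near: n; exists 1%N.
have /andP[+ _] := powR_incr_bounds (ltW r1) n0.
apply: le_trans.
(* Taking the root of order r - 1 and raising it back needs a nonnegative base, hence the maximum;
   this root is the threshold for n. *)
have A1 : 0 <= Num.max A 0 by rewrite le_max lexx orbT.
apply: (@le_trans _ _ (Num.max A 0)); first by rewrite le_max lexx.
apply: (@le_trans _ _ (n%:R `^ (r - 1))); last first.
  by rewrite ler_peMl ?powR_ge0// ltW.
have -> : Num.max A 0 = ((Num.max A 0) `^ (r - 1)^-1) `^ (r - 1).
  by rewrite -powRrM mulVf ?gt_eqF// powRr1.
rewrite ge0_ler_powR ?nnegrE ?powR_ge0//; first exact: ltW.
by near: n; exact: nbhs_infty_ger.
Unshelve. all: by end_near.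
Qed.

Lemma bounded_not_cvgy {R : realType} (u : nat -> R) (M : R) :
  (forall n, (0 < n)%N -> u n <= M) -> ~ (EFin (u n) @[n --> \oo] --> +oo%E).
Proof.
move=> uM /cvgeryP /cvgryPgt /(_ M) [N _ /(_ N.+1 (leqnSn _))] /=.
by rewrite ltNge uM.
Qed.

(** Increments of a centered process have mean zero, so their product moment is a covariance, which
    expands bilinearly. *)
Lemma increment_covE {R : realType} {d : measure_display}
    {T : measurableType d} (P : probability T R)
    (X : {nonneg R} -> {RV P >-> R}) (p q : nat) :
  (forall t, (X t : T -> R) \in Lfun P 2%:E) -> centered_process P X ->
  let Xn (n : nat) : {RV P >-> R} := X n%:R%:nng in
  increment_cov P X p q =
  (covariance P (Xn p.+1) (Xn q.+1) - covariance P (Xn p.+1) (Xn q)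
   - (covariance P (Xn p) (Xn q.+1) - covariance P (Xn p) (Xn q)))%E.
Proof.
move=> L2 X0 Xn.
have Pfin : P setT \is a fin_num := fin_num_measure P _ measurableT.
have Xn2 n : (Xn n : T -> R) \in Lfun P 2%:E := L2 _.
have Xn1 n := Lfun_subset12 Pfin (Xn2 n).
have incr2 n : (Xn n.+1 \- Xn n : T -> R) \in Lfun P 2%:E.
  by rewrite rpredB => [||h|h]; [by []|by rewrite lee1n|exact: Xn2|exact: Xn2].
have incrE n : ('E_P[Xn n.+1 \- Xn n] = 0)%E.
  by rewrite expectationB// !X0 sube0.
rewrite -!covarianceBr// -covarianceBl// unlock !incrE.
congr expectation; apply/funext => w; rewrite !fctE /= !subr0 /Xn.
by congr ((X _ w - X _ w) * (X _ w - X _ w)); exact: val_inj.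
Qed.

(** * Covariances of the gfBm and of its increments *)

Section fBm_increments.
Context {R : realType} {d : measure_display} {T : measurableType d}.
Context (P : probability T R) (H : R) (B : R -> {RV P >-> R}).
Context (hB : two_sided_fBm P H B).

Lemma fBm_Lfun2 t : (B t : T -> R) \in Lfun P 2%:E.
Proof.
have [_ B0 /(_ t t)] := hB; rewrite unlock => e.
apply: Lfun2_sqr_lty.
(* The mean is 0, so the second moment is the variance, a real number by the covariance formula. *)
have -> : ((B t : T -> R) * B t = (B t \- cst (fine 'E_P[B t])) *
    (B t \- cst (fine 'E_P[B t])))%R.
  by apply/funext => w /=; rewrite B0 !fctE/= subr0.
by rewrite e ltry.
Qed.

Lemma gfBm_Lfun2 a b t : (gfBm P a b B t : T -> R) \in Lfun P 2%:E.
Proof.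
have h c u : (c \o* B u : T -> R) \in Lfun P 2%:E.
  by rewrite Lfun_scale ?ler1n ?fBm_Lfun2.
rewrite [X in X \in _](_ : _ = (a \o* B t%:num \+ b \o* B (- t%:num))%R)//.
rewrite rpredD => [||p1|p1]; [by []|by rewrite lee1n|exact: h|exact: h].
Qed.

(** The products with equal signs of time carry a^2 and b^2 and see the distance |t - s|; the two
    mixed ones carry a b and see the distance s + t. *)
Lemma covariance_gfBm a b (s t : {nonneg R}) :
  covariance P (gfBm P a b B s) (gfBm P a b B t) =
  ((a ^+ 2 + b ^+ 2) / 2 * (s%:num `^ (2 * H) + t%:num `^ (2 * H)
                              - `|t%:num - s%:num| `^ (2 * H))
   + a * b * (s%:num `^ (2 * H) + t%:num `^ (2 * H)
                - (s%:num + t%:num) `^ (2 * H)))%:E.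
Proof.
have Pfin : P setT \is a fin_num := fin_num_measure P _ measurableT.
have L2 := fBm_Lfun2.
have L1 u : (B u : T -> R) \in Lfun P 1 := Lfun_subset12 Pfin (L2 u).
have L11 u v : ((B u : T -> R) * B v)%R \in Lfun P 1 :=
  Lfun2_mul_Lfun1 (L2 u) (L2 v).
have L2Z c u : (c \o* B u : T -> R) \in Lfun P 2%:E.
  by rewrite Lfun_scale ?ler1n.
have ZZ c e u v : covariance P (c \o* B u) (e \o* B v) =
    (c * e * (2^-1 * (`|u| `^ (2 * H) + `|v| `^ (2 * H)
                        - `|v - u| `^ (2 * H))))%:E.
  have [_ _ cB] := hB.
  rewrite covarianceZl//; last 2 first.
    exact: Lfun_subset12.
    exact: Lfun2_mul_Lfun1.
  by rewrite covarianceZr// covarianceC cB -!EFinM mulrA.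
rewrite [LHS](_ : _ = covariance P (a \o* B s%:num \+ b \o* B (- s%:num))
    (a \o* B t%:num \+ b \o* B (- t%:num)))//.
rewrite covarianceDl//; last exact: gfBm_Lfun2.
rewrite !covarianceDr// !ZZ -!EFinD; congr EFin.
rewrite !normrN !opprK -opprD normrN !(addrC (- _)) (distrC s%:num).
have s0 : 0 <= s%:num by [].
have t0 : 0 <= t%:num by [].
rewrite (ger0_norm (addr_ge0 t0 s0)) (ger0_norm s0) (ger0_norm t0).
by rewrite (addrC t%:num s%:num); field.
Qed.

Lemma centered_gfBm a b : centered_process P (gfBm P a b B).
Proof.
move=> t.
have Pfin : P setT \is a fin_num := fin_num_measure P _ measurableT.
have L1 u : (B u : T -> R) \in Lfun P 1 := Lfun_subset12 Pfin (fBm_Lfun2 u).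
have [_ B0 _] := hB.
rewrite [LHS](_ : _ = 'E_P[a \o* B t%:num \+ b \o* B (- t%:num)])%E//.
rewrite expectationD ?Lfun_scale//.
by rewrite !expectationZl// !B0 !mule0 adde0.
Qed.

(** The powers of single times cancel. The time differences n, n + 1, n + 2 and the time sums from
    2p + n + 1 to 2p + n + 3 leave two second differences; the lag is written n + 1 to avoid a
    predecessor. *)
Lemma increment_cov_gfBm_powR_incr a b p n :
  increment_cov P (gfBm P a b B) p (p + n.+1) =
  ((a ^+ 2 + b ^+ 2) / 2 * (powR_incr (2 * H) n.+1 - powR_incr (2 * H) n)
   - a * b * (powR_incr (2 * H) (n.+1 + p.*2.+1)
                - powR_incr (2 * H) (n + p.*2.+1)))%:E.
Proof.
rewrite increment_covE; [|exact: gfBm_Lfun2|exact: centered_gfBm].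
rewrite !covariance_gfBm -!EFinB; congr EFin => /=.
rewrite /powR_incr -!natrD.
have -> : (p + n.+1)%:R - p%:R = n.+1%:R :> R.
  by rewrite natrD addrAC subrr add0r.
have -> : (p + n.+1).+1%:R - p%:R = n.+2%:R :> R.
  by rewrite -addnS natrD addrAC subrr add0r.
have -> : (p + n.+1)%:R - p.+1%:R = n%:R :> R.
  by rewrite addnS -addSn natrD addrAC subrr add0r.
have -> : (p + n.+1).+1%:R - p.+1%:R = n.+1%:R :> R.
  by rewrite -addSn natrD addrAC subrr add0r.
rewrite !normr_nat.
have -> : (p.+1 + (p + n.+1).+1 = (n.+1 + p.*2.+1).+1)%N by lia.
have -> : (p.+1 + (p + n.+1) = n.+1 + p.*2.+1)%N by lia.
have -> : (p + (p + n.+1).+1 = n.+1 + p.*2.+1)%N by lia.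
have -> : (p + (p + n.+1) = n + p.*2.+1)%N by lia.
have -> : ((n + p.*2.+1).+1 = n.+1 + p.*2.+1)%N by lia.
by ring.
Qed.

Lemma sum_increment_cov_gfBm a b p N :
  (\sum_(1 <= n < N.+1) increment_cov P (gfBm P a b B) p (p + n))%E =
  ((a ^+ 2 + b ^+ 2) / 2 * (powR_incr (2 * H) N - powR_incr (2 * H) 0)
   - a * b * (powR_incr (2 * H) (N + p.*2.+1)
                - powR_incr (2 * H) p.*2.+1))%:E.
Proof.
rewrite big_add1 /=.
under eq_bigr do rewrite increment_cov_gfBm_powR_incr.
rewrite sumEFin sumrB -!big_distrr /= telescope_sumr//.
by rewrite (telescope_sumr (fun n => powR_incr (2 * H) (n + p.*2.+1))).
Qed.

End fBm_increments.

(** * Boundedness or divergence of the partial sums *)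

Theorem theorem1 (R : realType) (d : measure_display) (T : measurableType d)
  (P : probability T R) (H : R) (hH : 0 < H < 1) (B : R -> {RV P >-> R})
  (hB : two_sided_fBm P H B) (a b : R) (hab : (a, b) <> (0, 0)) :
  long_range_dependent P (gfBm P a b B) <-> 2^-1 < H /\ a <> b.
Proof.
have r0 : 0 <= 2 * H by lra.
split=> [lrd|[H2 ab] p p1].
(* The single value p = 1 suffices here; the shift 2p + 1 is then 3. *)
- have := lrd 1%N isT; under eq_fun do rewrite (sum_increment_cov_gfBm hB).
  set D := powR_incr (2 * H) => lim.
  have [H2|H2] := lerP H 2^-1.
  + have r1 : 0 <= 2 * H <= 1 by lra.
    (* All values of D lie in [0, 1], so their differences are at most 1 in absolute value. *)
    exfalso; pose M := (a ^+ 2 + b ^+ 2) / 2 + `|a * b|.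
    apply: (@bounded_not_cvgy _ _ M) lim => n _.
    rewrite lerD//.
      rewrite ler_piMr ?divr_ge0 ?addr_ge0 ?sqr_ge0//.
      by rewrite lerBlDr (le_trans (powR_incr_le1 _ r1))// lerDl powR_incr_ge0.
    apply: le_trans (ler_norm _) _; rewrite normrN normrM ler_piMr//.
    have := powR_incr_le1 (n + 3) r1; have := powR_incr_le1 3 r1.
    have := powR_incr_ge0 (n + 3) r0; have := powR_incr_ge0 3 r0.
    by rewrite ler_norml -/D; lra.
  + split=> // ab; subst b.
    (* For a = b the terms D n and D (n + 3) have opposite coefficients; a shift by 3 costs at most
       2H * 4, and - D 0 <= 0 is dropped. *)
    pose M := a ^+ 2 * (2 * H * 4%:R + D 3).
    apply: (@bounded_not_cvgy _ _ M) lim => n n0.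
    have r12 : 1 <= 2 * H <= 2 by lra.
    have := powR_incr_shift 3 r12 n0; rewrite ler_norml => /andP[h _].
    have D0 := powR_incr_ge0 0 r0.
    rewrite [leLHS](_ : _ = a ^+ 2 * (D n - D 0 - D (n + 3) + D 3)); last first.
      by rewrite expr2; field.
    by rewrite ler_wpM2l ?sqr_ge0//; move: h D0; rewrite -/D; lra.
- under eq_fun do rewrite (sum_increment_cov_gfBm hB).
  set D := powR_incr (2 * H).
  have r12 : 1 <= 2 * H <= 2 by lra.
  have r1 : 1 < 2 * H by lra.
  (* The coefficient of D n once D (n + 2p + 1) is replaced by D n; [M] collects the initial terms
     and the cost of this replacement, so the partial sum is at least c D n - M. *)
  pose c := (a - b) ^+ 2 / 2.
  have c0 : 0 < c by rewrite divr_gt0// exprn_even_gt0// subr_eq0; apply/eqP.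
  pose M := (a ^+ 2 + b ^+ 2) / 2 * D 0 - a * b * D p.*2.+1
              + `|a * b| * (2 * H * p.*2.+2%:R).
  apply/cvgeryP/cvgryPge => A.
  near=> n.
  have n0 : (0 < n)%N by near: n; exists 1%N.
  have hn : (A + M) / c <= D n.
    by near: n; have /cvgryPge := cvgy_powR_incr r1; exact.
  have : a * b * (D (n + p.*2.+1) - D n) <= `|a * b| * (2 * H * p.*2.+2%:R).
    apply: le_trans (ler_norm _) _.
    by rewrite normrM ler_wpM2l// powR_incr_shift.
  move: hn; rewrite ler_pdivrMr// /M /c; lra.
Unshelve. all: by end_near.
Qed.
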